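(* Let $\beta$ be the unique solution of $E\big(L'(\beta Z)\big)=0$ where $Z\sim \mathrm{Gamma}(b-a+1,1)$, and let $Z_1=V_2/V_1$. If $\beta\le c_{01}$, then the risk of the estimator $\delta_{1S1}=\min\{c_{01},\beta(1+Z_1)\}V_1$ of $\sigma_1$ is nowhere larger than the risk of $\delta_{01}=c_{01}V_1$ under the bowl-shaped loss $L$, that is, $R(\theta,\delta_{1S1})\le R(\theta,\delta_{01})$ for all $\theta$.
   Context: Fix integers $1\le a_i<b_i\le n_i$, $i=1,2$, and put $a=a_1+a_2$, $b=b_1+b_2$. The unknown parameter is $\theta=(\mu_1,\mu_2,\sigma_1,\sigma_2)$ with $\mu_1,\mu_2\in\mathbb{R}$ and $0<\sigma_1\le\sigma_2$. From a random sample of size $n_i$ from the exponential distribution with density $\sigma_i^{-1}e^{-(x-\mu_i)/\sigma_i}$, $x>\mu_i$, one observes only the order statistics of ranks $a_i,\dots,b_i$ (doubly type-II censored sample). A complete sufficient statistic is $(X_{a_1},X_{a_2},V_1,V_2)$, consisting of four independent random variables, where $X_{a_i}$ has density $$\frac{n_i!}{(a_i-1)!(n_i-a_i)!}\Big[1-e^{-\frac{x-\mu_i}{\sigma_i}}\Big]^{a_i-1}\frac1{\sigma_i}\Big[e^{-\frac{x-\mu_i}{\sigma_i}}\Big]^{n_i-a_i+1},\quad x>\mu_i,$$ and $V_i$ has the gamma distribution with shape $b_i-a_i$ and scale $\sigma_i$. $\mathrm{Gamma}(k,1)$ denotes the gamma distribution with shape $k$ and scale $1$. The loss for estimating $\sigma_1$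 by $\delta$ is $L(\delta/\sigma_1)$, where $L$ is differentiable and: (i) $L(t)$ is bowl-shaped with minimum value $0$ attained at $t=1$, decreasing for $t\le1$ and increasing for $t\ge1$; (ii) all integrals involving $L$ are finite and differentiation under the integral sign is permissible. The risk is $R(\theta,\delta)=E_\theta L(\delta/\sigma_1)$. The best affine equivariant estimator (BAEE) of $\sigma_1$ is $\delta_{01}=c_{01}V_1$, where $c_{01}$ is the unique solution of $E_{\sigma_1=1}\big(L'(c_{01}V_1)V_1\big)=0$. *)

(* Defs.v *)
From HB Require Import structures.
From mathcomp Require Import all_boot all_order all_algebra.
From mathcomp Require Import all_classical all_reals all_analysis.
Import Order.TTheory GRing.Theory Num.Theory numFieldNormedType.Exports.

Set Implicit Arguments.
Unset Strict Implicit.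
Unset Printing Implicit Defensive.

Local Open Scope classical_set_scope.
Local Open Scope ring_scope.

(* The parameter space: means are unrestricted, scales are order restricted. *)
Record param (R : realType) := Param {
  mu1 : R;
  mu2 : R;
  sigma1 : R;
  sigma2 : R;
  sigma1_gt0 : 0 < sigma1;
  sigma1_le_sigma2 : sigma1 <= sigma2
}.

(* Shapes are positive integers here, so Gamma(k) = (k-1)!. *)
Definition gamma_pdf (R : realType) (k : nat) (s x : R) : R :=
  if 0 < x then x ^+ k.-1 * expR (- (x / s)) / ((k.-1)`!%:R * s ^+ k) else 0.

(* Density of the a-th order statistic of n iid variables with density
   s^-1 exp (- (x - m) / s) on x > m. *)
Definition exp_order_stat_pdf (R : realType) (n a : nat) (m s x : R) : R :=
  if m < x then
    n`!%:R / ((a.-1)`!%:R * (n - a)`!%:R)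
    * (1 - expR (- ((x - m) / s))) ^+ a.-1
    * s^-1 * expR (- ((x - m) / s)) ^+ (n - a + 1)
  else 0.

Definition has_density (R : realType) (d : measure_display)
    (T : measurableType d) (P : probability T R) (X : {mfun T >-> R})
    (f : R -> R) : Prop :=
  forall A : set R, measurable A ->
    distribution P X A = (\int[lebesgue_measure]_(x in A) (f x)%:E)%E.

(* Subfamilies need no separate clause: take some of the A_i to be setT. *)
Definition independent4 (R : realType) (d : measure_display)
    (T : measurableType d) (P : probability T R)
    (X1 X2 X3 X4 : {mfun T >-> R}) : Prop :=
  forall A1 A2 A3 A4 : set R,
    measurable A1 -> measurable A2 -> measurable A3 -> measurable A4 ->
    P (X1 @^-1` A1 `&` X2 @^-1` A2 `&` X3 @^-1` A3 `&` X4 @^-1` A4)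
    = (P (X1 @^-1` A1) * P (X2 @^-1` A2)
       * P (X3 @^-1` A3) * P (X4 @^-1` A4))%E.

(* The statistical model of the complete sufficient statistic: the statistics
   are fixed functions on the sample space, P th is the law under th. *)
Definition censored_exp_model (R : realType) (n1 n2 a1 a2 b1 b2 : nat)
    (d : measure_display) (T : measurableType d)
    (P : param R -> probability T R) (X1 X2 V1 V2 : {mfun T >-> R}) : Prop :=
  forall th : param R,
    [/\ independent4 (P th) X1 X2 V1 V2,
        has_density (P th) X1 (exp_order_stat_pdf n1 a1 (mu1 th) (sigma1 th)),
        has_density (P th) X2 (exp_order_stat_pdf n2 a2 (mu2 th) (sigma2 th)),
        has_density (P th) V1 (gamma_pdf (b1 - a1) (sigma1 th)) &
        has_density (P th) V2 (gamma_pdf (b2 - a2) (sigma2 th))].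

(* Losses are only evaluated at positive ratios (almost surely), so nothing is
   assumed on t <= 0; e.g. t - ln t - 1 is allowed.  Monotonicity is weak. *)
Definition bowl_shaped (R : realType) (L : R -> R) : Prop :=
  [/\ L 1 = 0,
      forall s t : R, 0 < s -> s <= t -> t <= 1 -> L t <= L s &
      forall s t : R, 1 <= s -> s <= t -> L s <= L t].

Definition gamma_mean (R : realType) (k : nat) (g : R -> R) : \bar R :=
  (\int[lebesgue_measure]_x (g x * gamma_pdf k 1 x)%:E)%E.

Definition gamma_integrable (R : realType) (k : nat) (g : R -> R) : Prop :=
  lebesgue_measure.-integrable setT
    (fun x : R => (g x * gamma_pdf k 1 x)%:E).

(* Finiteness of the integrals of L and differentiation under the integral
   sign, for c |-> E (L (c * Z)) with Z ~ Gamma(k, 1). *)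
Definition regular_loss (R : realType) (L : R -> R) (k : nat) : Prop :=
  forall c : R, 0 < c ->
    [/\ gamma_integrable k (fun x => L (c * x)),
        gamma_integrable k (fun x => derive1 L (c * x) * x) &
        is_derive c 1 (fun c' : R => fine (gamma_mean k (fun x => L (c' * x))))
          (fine (gamma_mean k (fun x => derive1 L (c * x) * x)))].

Definition risk (R : realType) (d : measure_display) (T : measurableType d)
    (L : R -> R) (P : param R -> probability T R) (th : param R)
    (delta : T -> R) : \bar R :=
  'E_(P th)[fun w => (L (delta w / sigma1 th))%R]%E.

(* c is the constant of the best affine equivariant estimator c * V1. *)
Definition is_baee_constant (R : realType) (d : measure_display)
    (T : measurableType d) (L : R -> R) (P : param R -> probability T R)
    (V1 : T -> R) (c : R) : Prop :=
  unique (fun c' : R => 0 < c' /\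
    forall th : param R, sigma1 th = 1 ->
      'E_(P th)[fun w => (derive1 L (c' * V1 w) * V1 w)%R]%E = 0%E) c.

Definition delta01 (R : realType) (T : Type) (c01 : R) (V1 : T -> R) : T -> R :=
  fun w => c01 * V1 w.

Definition delta1S1 (R : realType) (T : Type) (c01 beta : R)
    (V1 V2 : T -> R) : T -> R :=
  fun w => let Z1 := V2 w / V1 w in Num.min c01 (beta * (1 + Z1)) * V1 w.

(* Main.v *)
(* Conditionally on Z1 = V2/V1 = z, the variable V1 is gamma distributed with
   shape b - a and scale 1/(1/sigma1 + z/sigma2), so the risk of phi(Z1) V1 is
   a nonnegative mixture over z of the values G(c), c = phi(z)/(1 + eta z),
   where eta = sigma1/sigma2 <= 1 and G(c) = E L(c Y) with Y ~ Gamma(b - a, 1).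
   Since beta is a zero of G' and L' changes sign from - to + at 1, the monotone
   likelihood ratio of the gamma scale family gives G' >= 0 on [beta, +oo[.
   When phi(z) = beta (1 + z) < c01 we have beta <= phi(z)/(1 + eta z)
   <= c01/(1 + eta z), hence replacing c01 by phi(z) does not increase G. *)
From HB Require Import structures.
Require Import Defs.
From mathcomp Require Import all_boot all_order all_algebra.
From mathcomp Require Import all_classical all_reals all_analysis.
From mathcomp Require Import measurable_realfun ring zify.
Import Order.TTheory GRing.Theory Num.Theory numFieldNormedType.Exports.
Local Open Scope classical_set_scope.
Local Open Scope ring_scope.

(** * Integration *)

Section null_set.
Local Open Scope ereal_scope.
Context d (T : measurableType d) (R : realType).
Context (mu : {measure set T -> \bar R}).
Import HBNNSimple.

(* [f] and [g] need not be measurable. *)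
Lemma ge0_le_integral_off_null (N : set T) (f g : T -> \bar R) :
  measurable N -> mu N = 0 ->
  (forall x, 0 <= f x) -> (forall x, 0 <= g x) ->
  (forall x, ~ N x -> f x <= g x) ->
  \int[mu]_x f x <= \int[mu]_x g x.
Proof.
move=> mN N0 f0 g0 fg; rewrite !ge0_integralTE//.
(* The integral of a nonnegative function is the supremum over the simple functions below it. A
   simple [h] below [f], set to 0 on [N], lies below [g] and keeps its integral. *)
apply: ge_ereal_sup => _ [h /= hf <-].
have mNC : measurable (~` N) by exact: measurableC.
apply: ereal_sup_ubound => /=.
exists (proj_nnsfun h mNC).
  move=> x; have [Nx|Nx] := pselect (N x).
    by rewrite /= mindicE memNset ?mulr0//; exact.
  by rewrite /= mindicE mem_set//= mulr1 (le_trans (hf x))// fg.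
rewrite -!integralT_nnsfun.
rewrite [RHS](@ge0_negligible_integral _ _ _ _ _ N)//; last 2 first.
  by apply/measurable_EFinP.
  by move=> x _; rewrite lee_fin.
rewrite setTD [RHS]integral_mkcond; apply: eq_integral => x _.
by rewrite patchE /= mindicE; case: ifPn => // _; rewrite ?mulr1 ?mulr0.
Qed.

Lemma eq_integral_off_null (N : set T) (f g : T -> \bar R) :
  measurable N -> mu N = 0 -> (forall x, ~ N x -> f x = g x) ->
  \int[mu]_x f x = \int[mu]_x g x.
Proof.
move=> mN N0 fg.
rewrite integralE [RHS]integralE.
by congr (_ - _); apply/eqP; rewrite eq_le; apply/andP; split;
  apply: (@ge0_le_integral_off_null N) => // x Nx;
  rewrite ?funeposE ?funenegE (fg x Nx).
Qed.

End null_set.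

(** * Integration against a measure given by a density *)

Section density.
Local Open Scope ereal_scope.
Context d (T : measurableType d) (R : realType).
Context (mu nu : {measure set T -> \bar R}) (p : T -> R).
Hypotheses (mp : measurable_fun setT p) (p0 : forall x, (0 <= p x)%R).
Hypothesis nuE : forall A, measurable A -> nu A = \int[mu]_(x in A) (p x)%:E.
Import HBNNSimple.

Lemma nnsfun_integral_density (h : {nnsfun T >-> R}) :
  \int[nu]_x (h x)%:E = \int[mu]_x ((h x)%:E * (p x)%:E).
Proof.
under eq_integral do rewrite fimfunE -fsumEFin//.
rewrite ge0_integral_fsum//; last 2 first.
- by move=> r; exact/measurable_EFinP/measurable_funM.
- by move=> r x _; rewrite nnfun_muleindic_ge0.
under [RHS]eq_integral.
  move=> x _; rewrite fimfunE -fsumEFin// ge0_mule_fsuml; last first.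
    by move=> r; rewrite EFinM nnfun_muleindic_ge0.
  over.
rewrite [RHS]ge0_integral_fsum//; last 2 first.
- by move=> r; apply: emeasurable_funM;
    apply/measurable_EFinP => //; exact: measurable_funM.
- by move=> r x _; rewrite mule_ge0 ?lee_fin// -lee_fin EFinM
    nnfun_muleindic_ge0.
apply: eq_fsbigr => r /[!inE] -[t _ <-].
under eq_integral do rewrite EFinM.
under [RHS]eq_integral do rewrite EFinM -muleA.
rewrite !ge0_integralZl//; last 5 first.
- by apply: emeasurable_funM; apply/measurable_EFinP.
- by move=> x _; rewrite mule_ge0 ?lee_fin.
- by rewrite lee_fin.
- exact/measurable_EFinP.
- by rewrite lee_fin.
congr (_ * _); rewrite integral_indic// setIT nuE//.
rewrite integral_mkcond; apply: eq_integral => x _.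
by rewrite patchE indicE; case: ifPn => _; rewrite ?mul1e ?mul0e.
Qed.

(** Monotone convergence on both sides, along simple functions increasing to [f]. *)
Lemma ge0_integral_density (f : T -> \bar R) :
  measurable_fun setT f -> (forall x, 0 <= f x) ->
  \int[nu]_x f x = \int[mu]_x (f x * (p x)%:E).
Proof.
move=> mf f0; pose f_ := nnsfun_approx measurableT mf.
have cf x : EFin \o f_ ^~ x @ \oo --> f x by exact: cvg_nnsfun_approx.
transitivity (limn (fun n => \int[nu]_x (f_ n x)%:E)).
  rewrite -monotone_convergence//=.
  - by apply: eq_integral => x _; apply/esym/cvg_lim => //; exact: cf.
  - by move=> n; exact/measurable_EFinP.
  - by move=> n x _; rewrite lee_fin.
  - by move=> x _ a b ab; rewrite lee_fin//; exact/lefP/nd_nnsfun_approx.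
under eq_fun do rewrite nnsfun_integral_density.
rewrite -monotone_convergence//=.
- apply: eq_integral => x _; apply/cvg_lim => //.
  by apply: cvgeZr => //; exact: cf.
- by move=> n; apply: emeasurable_funM; exact/measurable_EFinP.
- by move=> n x _; rewrite mule_ge0 ?lee_fin.
- move=> x _ a b ab; rewrite lee_wpmul2r ?lee_fin//.
  exact/lefP/nd_nnsfun_approx.
Qed.

End density.

(** * Dilations of Lebesgue measure *)

Section scaling.
Local Open Scope ereal_scope.
Context (R : realType).
Local Notation lambda := (@lebesgue_measure R).

Lemma measurable_fun_scale (c : R) :
  measurable_fun [set: measurableTypeR R]
    (fun x : measurableTypeR R => (c * x)%R : measurableTypeR R).
Proof. exact: mulrl_measurable. Qed.

(** [c] times the image of Lebesgue measure under $x \mapsto cx$ agrees with Lebesgue measure on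
    half-open intervals, hence everywhere. *)
Lemma ge0_integral_scale (c : R) (f : R -> \bar R) : (0 < c)%R ->
  measurable_fun [set: R] f -> (forall x, 0 <= f x) ->
  \int[lambda]_x f x = c%:E * \int[lambda]_x f (c * x)%R.
Proof.
move=> c0 mf f0.
rewrite -(@ge0_integral_pushforward _ _ _ _ _ _
  (measurable_fun_scale c) _ setT)//.
rewrite -(@ge0_integral_mscale _ _ _ _ _ _ (NngNum (ltW c0)))//.
  exact: measurable_fun_scale.
move=> mscale_c; apply: eq_measure_integral => A mA _.
apply: lebesgue_measure_unique => // _ [[a b]] _ <-.
transitivity (c%:E * lambda `](c^-1 * a)%R, (c^-1 * b)%R]%classic); last first.
  change (c%:E * lambda `](c^-1 * a)%R, (c^-1 * b)%R]%classic =
          c%:E * lambda ([eta *%R c] @^-1` `]a, b]%classic)).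
  congr (_ * lambda _); apply/seteqP.
  by split => x /=; rewrite !in_itv/= ler_pdivlMl// ltr_pdivrMl.
rewrite !lebesgue_measure_itv/= !lte_fin ltr_pM2l ?invr_gt0//.
case: ifPn => _; last by rewrite mule0.
by rewrite -!EFinB -EFinM -mulrBr mulrA divff ?gt_eqF// mul1r.
Qed.

Lemma integral_scale (c : R) (f : R -> \bar R) : (0 < c)%R ->
  measurable_fun [set: R] f ->
  \int[lambda]_x f x = c%:E * \int[lambda]_x f (c * x)%R.
Proof.
move=> c0 mf; rewrite integralE [X in _ = _ * X]integralE.
rewrite [X in X - _](ge0_integral_scale _ _ c0)//; last first.
  exact: measurable_funepos.
rewrite [X in _ - X](ge0_integral_scale _ _ c0)//; last first.
  exact: measurable_funeneg.
have -> : (fun x => f (c * x)%R)^\+ = fun x => f^\+ (c * x)%R.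
  by apply/funext => x; rewrite !funeposE.
have -> : (fun x => f (c * x)%R)^\- = fun x => f^\- (c * x)%R.
  by apply/funext => x; rewrite !funenegE.
set x := integral _ _ _; set y := integral _ _ _.
(* Multiplication by [c > 0] distributes over the difference at infinite values as well, so
   integrability is not assumed. *)
case: x y => [x| |] [y| |] //=; rewrite ?gt0_muley ?gt0_muleNy ?lte_fin//=.
by change ((c * x - c * y)%:E = (c * (x - y))%:E); rewrite mulrBr.
Qed.

End scaling.

(* [measurableTypeR R], on which Lebesgue measure lives, is [R] with the same
   sigma-algebra but another display. *)
Section joint_density.
Local Open Scope ereal_scope.
Context d (T : measurableType d) (R : realType) (P : probability T R).
Local Notation lambda := (@lebesgue_measure R).
Context (X Y : {mfun T >-> measurableTypeR R}) (p q : measurableTypeR R -> R).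
Hypothesis indep : forall A B : set (measurableTypeR R),
  measurable A -> measurable B ->
  P (X @^-1` A `&` Y @^-1` B) = P (X @^-1` A) * P (Y @^-1` B).
Hypotheses (mp : measurable_fun setT p) (p0 : forall x, (0 <= p x)%R).
Hypotheses (mq : measurable_fun setT q) (q0 : forall x, (0 <= q x)%R).
Hypothesis Xp : forall A : set (measurableTypeR R), measurable A ->
  P (X @^-1` A) = \int[lambda]_(x in A) (p x)%:E.
Hypothesis Yq : forall A : set (measurableTypeR R), measurable A ->
  P (Y @^-1` A) = \int[lambda]_(x in A) (q x)%:E.

(** Independence makes the law of the pair a product measure; Tonelli and the two densities then
    give an iterated Lebesgue integral. *)
Lemma ge0_integral_joint_density
    (h : measurableTypeR R * measurableTypeR R -> \bar R) :
  measurable_fun setT h -> (forall z, 0 <= h z) ->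
  \int[P]_w h (X w, Y w) =
  \int[lambda]_x \int[lambda]_y (h (x, y) * (q y)%:E * (p x)%:E).
Proof.
move=> mh h0.
have mXY : measurable_fun setT (fun w => (X w, Y w)).
  by apply: measurable_fun_pair.
pose XY : {mfun T >-> (measurableTypeR R * measurableTypeR R)%type} :=
  HB.pack (fun w => (X w, Y w)) (isMeasurableFun.Build _ _ _ _ _ mXY).
rewrite -(@ge0_integral_distribution _ _ _ _ _ P XY)//.
have -> : \int[distribution P XY]_z h z =
    \int[(distribution P X \x distribution P Y)]_z h z.
  apply: eq_measure_integral => A mA _; apply/esym.
  by apply: (@product_measure_unique _ _ _ _ _
    (distribution P X) (distribution P Y)).
rewrite fubini_tonelli1//.
rewrite (@ge0_integral_density _ _ _ lambda (distribution P X) p)//;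
    last 2 first.
  exact: (measurable_fun_fubini_tonelli_F h).
  by move=> x; apply: integral_ge0.
apply: eq_integral => x _; rewrite /fubini_F.
have mhx : measurable_fun setT (fun y => h (x, y)).
  by apply: measurableT_comp => //; exact: measurable_pair1.
rewrite (@ge0_integral_density _ _ _ lambda (distribution P Y) q)//.
rewrite -ge0_integralZr//.
- by apply: emeasurable_funM => //; exact/measurable_EFinP.
- by move=> y _; rewrite mule_ge0 ?lee_fin.
- by rewrite lee_fin.
Qed.

End joint_density.
(** * Bowl-shaped losses under gamma laws *)

Section derivative_sign.
Context (R : realType).

(** The difference quotient is the product in the hypothesis divided by $(y-x)^2$, so one inequality
    covers both sides of [x]. It is local because the loss is monotone only on each side of 1. *)
Lemma derive1_ge0_near (f : R -> R) (x : R) : derivable f x 1 ->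
  (\forall y \near x, 0 <= (y - x) * (f y - f x)) -> 0 <= derive1 f x.
Proof.
move=> df [e /= e0 fx]; rewrite derive1E; apply: limr_ge => //.
near=> h.
have h0 : h != 0 by near: h; exact: nbhs_dnbhs_neq.
have := fx (h *: 1 + x); rewrite /= addrK => H.
have {H} : 0 <= h * (f (h *: 1 + x) - f x).
  rewrite -[X in X * _](mulr1 h); apply: H.
  rewrite /ball/= distrC addrK scaler1; near: h.
  exact: dnbhs0_lt.
move=> H; rewrite /GRing.scale/=.
rewrite (_ : _^-1 * _ = h ^- 2 * (h * (f (h *: 1 + x) - f x))).
  by rewrite mulr_ge0// invr_ge0 sqr_ge0.
by field.
Unshelve. all: by end_near. Qed.

Lemma bowl_shaped_derive1_ge0 (L : R -> R) (t : R) : bowl_shaped L ->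
  1 < t -> derivable L t 1 -> 0 <= derive1 L t.
Proof.
move=> [_ _ Linc] t1 dL; apply: derive1_ge0_near => //.
near=> y; have y1 : 1 < y by near: y; exact: lt_nbhsr.
have [yt|ty] := leP y t.
  by rewrite mulr_le0// subr_le0// Linc// ltW.
by rewrite mulr_ge0// subr_ge0 ?Linc// ltW.
Unshelve. all: by end_near. Qed.

Lemma bowl_shaped_derive1_le0 (L : R -> R) (t : R) : bowl_shaped L ->
  0 < t < 1 -> derivable L t 1 -> derive1 L t <= 0.
Proof.
move=> [_ Ldec _] /andP[t0 t1] dL; rewrite -oppr_ge0 -derive1N//.
apply: derive1_ge0_near; first exact: derivableN.
near=> y; have y1 : y < 1 by near: y; exact: lt_nbhsl.
have y0 : 0 < y by near: y; exact: lt_nbhsr.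
rewrite (_ : (- L) y - (- L) t = L t - L y); last by rewrite !fctE opprK addrC.
have [yt|ty] := leP y t.
  by rewrite mulr_le0// subr_le0// Ldec// ltW.
by rewrite mulr_ge0// subr_ge0 ?Ldec// ltW.
Unshelve. all: by end_near. Qed.

End derivative_sign.

(** * Monotonicity of the expected loss $c \mapsto E\,L(cY)$ for gamma $Y$ *)

Section gamma_mean_monotone.
Context (R : realType) (L : R -> R).
Hypothesis dL : forall t : R, 0 < t -> derivable L t 1.
Hypothesis bowlL : bowl_shaped L.
Local Notation lambda := (@lebesgue_measure R).

Lemma gamma_pdf_ge0 (k : nat) (s x : R) : 0 < s -> 0 <= gamma_pdf k s x.
Proof.
move=> s0; rewrite /gamma_pdf; case: ifPn => // x0.
by rewrite divr_ge0// ?mulr_ge0 ?exprn_ge0 ?expR_ge0// ltW.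
Qed.

(* The factor makes both sides agree at [c * x = 1], where [L'] changes sign. *)
Lemma le_bowl_shaped_weight (k : nat) (c r x : R) : 0 < c -> 1 <= r ->
  r ^- k.+1 * expR ((r - 1) / c) *
    (derive1 L (c * x) * (r * x) * gamma_pdf k.+1 1 (r * x)) <=
  derive1 L (c * x) * x * gamma_pdf k.+1 1 x.
Proof.
move=> c0 r1.
have r0 : 0 < r by rewrite (lt_le_trans _ r1).
rewrite /gamma_pdf pmulr_rgt0//; case: ifPn => [x0|]; last by rewrite !mulr0.
rewrite -subr_ge0 !divr1 expr1n mulr1/=.
have -> : expR (- (r * x)) = expR (- x) * expR (- ((r - 1) * x)).
  by rewrite -expRD; congr expR; ring.
have fk0 : k`!%:R != 0 :> R by rewrite pnatr_eq0 -lt0n fact_gt0.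
rewrite [leRHS](_ : _ = x ^+ k.+1 * expR (- x) / k`!%:R * (derive1 L (c * x) *
    (1 - expR ((r - 1) / c) * expR (- ((r - 1) * x))))); last first.
  rewrite exprMn !exprS; field.
  by rewrite fk0 expf_neq0 gt_eqF.
apply: mulr_ge0.
  by rewrite divr_ge0// mulr_ge0 ?exprn_ge0 ?expR_ge0// ltW.
(* There remains $L'(cx)\,(1 - e^{(r-1)(1-cx)/c})$. Both factors are nonpositive for $cx<1$ and
   nonnegative for $cx>1$; the second vanishes at $cx=1$. *)
rewrite -expRD (_ : (r - 1) / c - _ = (r - 1) * (1 - c * x) / c); last first.
  by field; rewrite gt_eqF.
have cx0 : 0 < c * x by rewrite mulr_gt0.
have [cx1|cx1|cx1] := ltgtP (c * x) 1.
- rewrite mulr_le0//.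
    by apply: bowl_shaped_derive1_le0 => //; [rewrite cx0|exact: dL].
  rewrite subr_le0 -[leLHS]expR0 ler_expR; apply: divr_ge0; last exact: ltW.
  by rewrite mulr_ge0 ?subr_ge0// ltW.
- rewrite mulr_ge0//.
    by apply: bowl_shaped_derive1_ge0 => //; exact: dL.
  rewrite subr_ge0 -[leRHS]expR0 ler_expR pmulr_lle0 ?invr_gt0//.
  by rewrite mulr_ge0_le0// ?subr_ge0// subr_le0 ltW.
- by rewrite cx1 subrr mulr0 mul0r expR0 subrr mulr0.
Qed.

(** The equation for [beta] says that [f] has integral 0, and so does its dilation by
    [r = c / beta]. A positive multiple of this dilation bounds the integrand at [c] from below. *)
Lemma gamma_mean_derive1_ge0 (k : nat) (beta c : R) : 0 < beta -> beta <= c ->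
  regular_loss L k.+1 ->
  gamma_mean k.+2 (fun z => derive1 L (beta * z)) = 0%E ->
  (0 <= gamma_mean k.+1 (fun x => derive1 L (c * x) * x)%R)%E.
Proof.
move=> b0 bc reg bE; have c0 : 0 < c by exact: lt_le_trans bc.
pose f x : \bar R := (derive1 L (beta * x) * x * gamma_pdf k.+1 1 x)%:E.
have intf : lambda.-integrable setT f by have [_] := reg _ b0.
have mf : measurable_fun setT f by exact: measurable_int intf.
(* Size biasing: $x$ times the gamma density of shape $k+1$ is $k+1$ times that of shape $k+2$.
   Hence the shift of shape in the equation for [beta]. *)
have fE x : f x = (k.+1%:R%:E *
    (derive1 L (beta * x) * gamma_pdf k.+2 1 x)%:E)%E.
  rewrite -EFinM; congr EFin; rewrite /gamma_pdf.
  case: ifPn => _; last by rewrite !mulr0.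
  have fk0 : k`!%:R != 0 :> R by rewrite pnatr_eq0 -lt0n fact_gt0.
  rewrite !expr1n divr1 /= exprS factS natrM; field.
  by rewrite fk0/= lt0r_neq0// ltr_pwDl.
have f0 : (\int[lambda]_x f x)%E = 0%E.
  under eq_integral do rewrite fE.
  rewrite integralZl//.
    by move: bE; rewrite /gamma_mean => ->; rewrite mule0.
  rewrite (_ : (fun _ => _) = (fun x => (k.+1%:R^-1)%:E * f x)%E).
    exact: integrableZl.
  by apply/funext => x; rewrite fE -!EFinM mulrA mulVf ?pnatr_eq0// mul1r.
pose r := c / beta.
have r0 : 0 < r by rewrite divr_gt0.
have r1 : 1 <= r by rewrite ler_pdivlMr// mul1r.
pose g x : \bar R := f (r * x).
have mg : measurable_fun setT g.
  by apply: measurableT_comp => //; exact: mulrl_measurable.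
have intg : lambda.-integrable setT g.
  apply/integrableP; split => //.
  move/integrableP : intf => [_].
  rewrite (ge0_integral_scale _ _ _ r0)//; last exact: measurableT_comp.
  case: (\int[lambda]_x `|f (r * x)%R|)%E => //=.
    by move=> ? _; rewrite ltry.
  by rewrite gt0_muley ?lte_fin.
have g0 : (\int[lambda]_x g x)%E = 0%E.
  have := integral_scale _ _ _ r0 mf; rewrite f0 => /esym/eqP.
  by rewrite mule_eq0 eqe gt_eqF//= => /eqP.
rewrite -[leLHS](mule0 (r ^- k.+1 * expR ((r - 1) / c))%:E) -g0 -integralZl//.
apply: le_integral => //.
- exact: integrableZl.
- by have [_] := reg _ c0.
- move=> x _; rewrite /g /f -EFinM lee_fin.
  have -> : beta * (r * x) = c * x by rewrite /r; field; rewrite gt_eqF.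
  exact: le_bowl_shaped_weight.
Qed.

(** By [regular_loss] the derivative at [c] is $E(L'(cY)Y)$, whose sign is known for [c > beta]. *)
Lemma gamma_mean_ndecr (k : nat) (beta c1 c2 : R) : 0 < beta ->
  regular_loss L k.+1 ->
  gamma_mean k.+2 (fun z => derive1 L (beta * z)) = 0%E ->
  beta <= c1 -> c1 <= c2 ->
  (gamma_mean k.+1 (fun x => L (c1 * x)%R) <=
   gamma_mean k.+1 (fun x => L (c2 * x)%R))%E.
Proof.
move=> b0 reg bE bc1 c12.
have c10 : 0 < c1 by exact: lt_le_trans bc1.
have c20 : 0 < c2 by exact: lt_le_trans c12.
have fin c : 0 < c -> gamma_mean k.+1 (fun x => L (c * x)) \is a fin_num.
  by move=> c0; have [? _ _] := reg _ c0; exact: integrable_fin_num.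
rewrite -(fineK (fin _ c10)) -(fineK (fin _ c20)) lee_fin.
apply: (@ger0_derive1_ndecry _
  (fun c => fine (gamma_mean k.+1 (fun x => L (c * x)))) beta) => //.
- move=> c; rewrite in_itv/= andbT => bc.
  by have [_ _ []] := reg _ (lt_trans b0 bc).
- move=> c; rewrite in_itv/= andbT => bc.
  have [_ _ dG] := reg _ (lt_trans b0 bc).
  rewrite derive1E derive_val fine_ge0//.
  exact: (gamma_mean_derive1_ge0 _ beta) (ltW bc) _ _.
- apply: derivable_within_continuous => c; rewrite in_itv/= andbT => bc.
  by have [_ _ []] := reg _ (lt_le_trans b0 bc).
Qed.

End gamma_mean_monotone.

(** * Gamma densities under scaling and conditioning on a ratio *)

Section gamma_kernel.
Context {R : realType}.
Local Notation lambda := (@lebesgue_measure R).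

Lemma measurable_gamma_pdf (k : nat) (s : R) :
  measurable_fun setT (gamma_pdf k s).
Proof.
apply: measurable_fun_if => //.
- exact: measurable_fun_ltr.
- apply: measurable_funTS; apply: measurable_funM => //.
  apply: measurable_funM; first exact: measurable_funX.
  apply: measurableT_comp => //; apply: measurableT_comp => //.
  exact: measurable_funM.
Qed.

Lemma ge0_integral_gamma_scale (k : nat) (s : R) (f : R -> R) : 0 < s ->
  measurable_fun setT f -> (forall x, 0 <= f x) ->
  (\int[lambda]_x (f x * gamma_pdf k.+1 s x)%:E =
   gamma_mean k.+1 (fun x => f (s * x)%R))%E.
Proof.
move=> s0 mf f0.
have mg : measurable_fun setT (fun x => f x * gamma_pdf k.+1 s x).
  by apply: measurable_funM => //; exact: measurable_gamma_pdf.
have g0 x : 0 <= f x * gamma_pdf k.+1 s x by rewrite mulr_ge0 ?gamma_pdf_ge0.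
rewrite (ge0_integral_scale _ _ _ s0); last 2 first.
- exact/measurable_EFinP.
- by move=> x; rewrite lee_fin.
rewrite -ge0_integralZl//; last 3 first.
- apply/measurable_EFinP; apply: measurableT_comp mg _.
  exact: mulrl_measurable.
- by move=> x _; rewrite lee_fin.
- by rewrite lee_fin ltW.
apply: eq_integral => x _; rewrite -EFinM; congr EFin.
rewrite /gamma_pdf pmulr_rgt0//; case: ifPn => x0; last by rewrite !mulr0.
rewrite expr1n divr1 (_ : s * x / s = x); last first.
  by rewrite mulrAC divff ?mul1r ?gt_eqF.
rewrite exprMn exprS/=; field.
by rewrite pnatr_eq0 -lt0n fact_gt0 expf_neq0 gt_eqF.
Qed.

(* For independent gamma variables [X] of scale [s1] and [Y] of scale [s2], this
   is the scale of the gamma law of [X] given [Y / X = z]. *)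
Definition ratio_scale (s1 s2 z : R) : R := (s1^-1 + z / s2)^-1.

(* The density of [Y / X], [X] and [Y] having shapes [k1.+1] and [k2.+1]. *)
Definition ratio_weight (k1 k2 : nat) (s1 s2 z : R) : R :=
  z ^+ k2 * (k1 + k2).+1`!%:R * ratio_scale s1 s2 z ^+ (k1 + k2).+2
  / (k1`!%:R * k2`!%:R * s1 ^+ k1.+1 * s2 ^+ k2.+1).

Lemma ratio_scale_gt0 (s1 s2 z : R) : 0 < s1 -> 0 < s2 -> 0 < z ->
  0 < ratio_scale s1 s2 z.
Proof. by move=> s10 s20 z0; rewrite invr_gt0 addr_gt0 ?divr_gt0 ?invr_gt0. Qed.

Lemma ratio_weight_ge0 (k1 k2 : nat) (s1 s2 z : R) : 0 < s1 -> 0 < s2 ->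
  0 < z -> 0 <= ratio_weight k1 k2 s1 s2 z.
Proof.
move=> s10 s20 z0; have /ltW s0 := ratio_scale_gt0 _ _ _ s10 s20 z0.
have [/ltW ? /ltW ? /ltW ?] := And3 s10 s20 z0.
by do ![exact: ler0n|apply: exprn_ge0|apply: divr_ge0|apply: mulr_ge0].
Qed.

(** The left side is the joint density of $(X, Y/X)$ at $(x,z)$, the last factor $x$ being the
    Jacobian of $y = xz$. Collecting powers of $x$ and adding the rates $1/s_1$ and $z/s_2$ factors
    it into marginal times conditional density. *)
Lemma gamma_pdf_ratio (k1 k2 : nat) (s1 s2 x z : R) :
  0 < s1 -> 0 < s2 -> 0 < z ->
  gamma_pdf k2.+1 s2 (x * z) * gamma_pdf k1.+1 s1 x * x =
  ratio_weight k1 k2 s1 s2 z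
  * gamma_pdf (k1 + k2).+2 (ratio_scale s1 s2 z) x.
Proof.
move=> s10 s20 z0; have s0 := ratio_scale_gt0 _ _ _ s10 s20 z0.
rewrite /gamma_pdf pmulr_lgt0//.
case: ifPn => x0; last by rewrite !(mulr0, mul0r).
rewrite /ratio_weight.
have -> : expR (- (x / ratio_scale s1 s2 z)) =
    expR (- (x / s1)) * expR (- (x * z / s2)).
  by rewrite -expRD; congr expR; rewrite /ratio_scale invrK; ring.
rewrite exprMn /= (_ : x ^+ (k1 + k2).+1 = x * x ^+ k1 * x ^+ k2); last first.
  by rewrite exprS exprD mulrA.
have nz n : n`!%:R != 0 :> R by rewrite pnatr_eq0 -lt0n fact_gt0.
move: (nz k1) (nz k2) (nz (k1 + k2).+1) => nz1 nz2 nz3.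
have e1 : s1 ^+ k1.+1 != 0 by rewrite expf_neq0 ?gt_eqF.
have e2 : s2 ^+ k2.+1 != 0 by rewrite expf_neq0 ?gt_eqF.
have e3 : ratio_scale s1 s2 z ^+ (k1 + k2).+2 != 0 by rewrite expf_neq0 ?gt_eqF.
move: (s1 ^+ _) (s2 ^+ _) (_ ^+ (k1 + k2).+2) e1 e2 e3 => u v w e1 e2 e3.
by field; rewrite nz1 nz2 nz3 e1 e2 e3.
Qed.

End gamma_kernel.

(** * Conditioning on the ratio *)

Section ratio_integral.
Local Open Scope ereal_scope.
Context (R : realType) (p q : measurableTypeR R -> R).
Local Notation lambda := (@lebesgue_measure R).
Hypotheses (mp : measurable_fun setT p) (p0 : forall x, (0 <= p x)%R).
Hypotheses (mq : measurable_fun setT q) (q0 : forall x, (0 <= q x)%R).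
Hypothesis p_le0 : forall x, (x <= 0)%R -> p x = 0%R.

(** Substitute $y = xz$ for each fixed $x>0$, with Jacobian $x$, then exchange the integrals by
    Tonelli; [p] vanishes for $x \le 0$. *)
Lemma ge0_integral_ratio (h : measurableTypeR R * measurableTypeR R -> \bar R) :
  measurable_fun setT h -> (forall z, 0 <= h z) ->
  \int[lambda]_x \int[lambda]_y (h (x, y) * (q y)%:E * (p x)%:E) =
  \int[lambda]_z \int[lambda]_x (h (x, (x * z)%R) * (q (x * z) * p x * x)%:E).
Proof.
move=> mh h0.
pose g (xz : measurableTypeR R * measurableTypeR R) : \bar R :=
  h (xz.1, (xz.1 * xz.2)%R) * (q (xz.1 * xz.2) * p xz.1 * xz.1)%:E.
have px0 x : (0 <= p x * x)%R.
  by have [/p_le0 ->|x0] := leP x 0%R; rewrite ?mul0r// mulr_ge0// ltW.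
have mprod : measurable_fun setT
    (fun xz : measurableTypeR R * measurableTypeR R =>
      xz.1 * xz.2 : measurableTypeR R)%R.
  by apply: measurable_funM.
have mg : measurable_fun setT g.
  apply: emeasurable_funM.
    apply: measurableT_comp mh _.
    exact: measurable_fun_pair.
  apply/measurable_EFinP; apply: measurable_funM => //.
  apply: measurable_funM; first exact: measurableT_comp mq _.
  exact: measurableT_comp mp _.
have g0 xz : 0 <= g xz by rewrite mule_ge0// lee_fin -mulrA mulr_ge0.
rewrite -[RHS](fubini_tonelli g)//; apply: eq_integral => x _.
have [x0|x0] := leP x 0%R.
  rewrite !integral0_eq// => y _.
    by rewrite /g/= p_le0// mulr0 mul0r mule0.
  by rewrite p_le0// mule0.
have mhx : measurable_fun setT (fun y => h (x, y) * (q y)%:E * (p x)%:E).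
  apply: emeasurable_funM => //.
  apply: emeasurable_funM; last exact/measurable_EFinP.
  by apply: measurableT_comp => //; exact: measurable_pair1.
rewrite (ge0_integral_scale _ _ _ x0)//; last first.
  by move=> y; rewrite !mule_ge0 ?lee_fin.
rewrite -ge0_integralZl//; last 3 first.
- by apply: measurableT_comp mhx _; exact: mulrl_measurable.
- by move=> y _; rewrite !mule_ge0 ?lee_fin.
- by rewrite lee_fin ltW.
apply: eq_integral => y _; rewrite /g/=.
by rewrite muleC -!muleA -!EFinM mulrA.
Qed.

End ratio_integral.

(** * Risk of $\phi(V_2/V_1)V_1$ as a mixture over the ratio *)

Section ratio_estimator.
Context d (T : measurableType d) (R : realType) (P : probability T R).
Context (V1 V2 : {mfun T >-> R}) (k1 k2 : nat) (s1 s2 : R) (L : R -> R).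
Local Notation lambda := (@lebesgue_measure R).
Hypotheses (s1_gt0 : 0 < s1) (s2_gt0 : 0 < s2).
Hypothesis indep : forall A B : set R, measurable A -> measurable B ->
  P (V1 @^-1` A `&` V2 @^-1` B) = (P (V1 @^-1` A) * P (V2 @^-1` B))%E.
Hypotheses (V1_gamma : has_density P V1 (gamma_pdf k1.+1 s1))
  (V2_gamma : has_density P V2 (gamma_pdf k2.+1 s2)).
Hypothesis dL : forall t : R, 0 < t -> derivable L t 1.
Hypothesis bowlL : bowl_shaped L.

Lemma gamma_density_null (V : {mfun T >-> R}) (k : nat) (s : R) :
  has_density P V (gamma_pdf k s) -> P (V @^-1` `]-oo, 0]) = 0%E.
Proof.
move=> Vg; rewrite -[LHS]/(distribution P V `]-oo, 0]) Vg//.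
apply: integral0_eq => x /=; rewrite in_itv/= => x0.
by rewrite /gamma_pdf ltNge x0.
Qed.

Lemma bowl_shaped_ge0 (t : R) : 0 < t -> 0 <= L t.
Proof.
move: bowlL => [L1 Ldec Linc] t0.
have [t1|/ltW t1] := leP t 1; first by rewrite -L1 Ldec.
by rewrite -L1 Linc.
Qed.

(* [L] is arbitrary on nonpositive arguments, possibly not even measurable. *)
Let Lpos : R -> R := L \_ `]0, +oo[.

Let Lpos_ge0 t : 0 <= Lpos t.
Proof.
rewrite /Lpos patchE; case: ifPn => //; rewrite inE/= in_itv/= andbT.
exact: bowl_shaped_ge0.
Qed.

Let LposE t : 0 < t -> Lpos t = L t.
Proof. by move=> t0; rewrite /Lpos patchE mem_set//= in_itv/= t0. Qed.

Let measurable_Lpos : measurable_fun setT Lpos.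
Proof.
apply/(measurable_restrictT _ _).1 => //.
apply: open_continuous_measurable_fun => //.
move=> t /set_mem; rewrite /= in_itv/= andbT => t0.
by apply: differentiable_continuous; apply/derivable1_diffP; exact: dL.
Qed.

(** Pass to the joint density, change variables to $(x, z = y/x)$ and factor by [gamma_pdf_ratio];
    rescaling to unit scale moves [ratio_scale] into the argument of [L]. *)
Lemma integral_ratio_estimator (phi : R -> R) : measurable_fun setT phi ->
  (forall z, 0 < z -> 0 < phi z) ->
  (\int[P]_w (L (phi (V2 w / V1 w)%R * V1 w / s1)%R)%:E =
  \int[lambda]_z (if (0 < z)%R then (ratio_weight k1 k2 s1 s2 z)%:E *
    gamma_mean (k1 + k2).+2
      (fun x => L (phi z * ratio_scale s1 s2 z / s1 * x)%R)
    else 0))%E.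
Proof.
move=> mphi phi0.
(* The power with exponent -1 is a measurable expression that equals the inverse on positive
   reals. *)
pose h (xy : measurableTypeR R * measurableTypeR R) : \bar R :=
  (Lpos (phi (xy.2 * xy.1 `^ (-1)) * (xy.1 / s1)))%:E.
have mh : measurable_fun setT h.
  apply/measurable_EFinP; apply: (measurableT_comp measurable_Lpos).
  apply: measurable_funM; last exact: measurable_funM.
  apply: (measurableT_comp mphi); apply: measurable_funM => //.
  exact: (measurableT_comp (measurable_powR _)).
have h0 xy : (0 <= h xy)%E by rewrite lee_fin.
(* Off this null set both variables are positive, so [Lpos] agrees with [L] at the ratio in
   question. *)
pose N := V1 @^-1` `]-oo, 0] `|` V2 @^-1` `]-oo, 0].
have mN : measurable N.
  by apply: measurableU; rewrite -[_ @^-1` _]setTI; exact: measurable_funP.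
have N0 : P N = 0%E.
  apply/eqP; rewrite eq_le measure_ge0 andbT.
  apply: (le_trans (measureU2 _ _ _)).
  - by rewrite -[_ @^-1` _]setTI; exact: measurable_funP.
  - by rewrite -[_ @^-1` _]setTI; exact: measurable_funP.
  by rewrite [X in (X + _)%E](gamma_density_null _ _ _ V1_gamma)
    [X in (_ + X)%E](gamma_density_null _ _ _ V2_gamma) adde0.
rewrite (@eq_integral_off_null _ _ _ _ N _ (fun w => h (V1 w, V2 w)))//;
    last first.
  move=> w; rewrite /N/= !in_itv/= => /not_orP[/negP + /negP +].
  rewrite -!ltNge => v1 v2; rewrite /h/= powR_inv1 ?(ltW v1)// LposE ?mulrA//.
  by rewrite divr_gt0 ?mulr_gt0 ?phi0 ?divr_gt0.
have mV (V : {mfun T >-> R}) : measurable_fun setT (V : T -> measurableTypeR R).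
  exact: (@measurable_funP _ _ _ _ setT V).
pose X1 : {mfun T >-> measurableTypeR R} :=
  HB.pack (V1 : T -> measurableTypeR R)
    (isMeasurableFun.Build _ _ _ _ _ (mV V1)).
pose X2 : {mfun T >-> measurableTypeR R} :=
  HB.pack (V2 : T -> measurableTypeR R)
    (isMeasurableFun.Build _ _ _ _ _ (mV V2)).
rewrite (@ge0_integral_joint_density _ _ _ P X1 X2 (gamma_pdf k1.+1 s1)
  (gamma_pdf k2.+1 s2))//; last 4 first.
- exact: measurable_gamma_pdf.
- by move=> x; exact: gamma_pdf_ge0.
- exact: measurable_gamma_pdf.
- by move=> x; exact: gamma_pdf_ge0.
rewrite (@ge0_integral_ratio _ (gamma_pdf k1.+1 s1) (gamma_pdf k2.+1 s2))//;
    last 5 first.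
- exact: measurable_gamma_pdf.
- by move=> x; exact: gamma_pdf_ge0.
- exact: measurable_gamma_pdf.
- by move=> x; exact: gamma_pdf_ge0.
- by move=> x x0; rewrite /gamma_pdf ltNge x0.
apply: eq_integral => z _; case: ifPn => [z0|]; last first.
  (* For $z \le 0$, $x$ and $xz$ cannot both be positive, so one of the two densities vanishes. *)
  rewrite -leNgt => z0; apply: integral0_eq => x _; rewrite /gamma_pdf.
  have [x0|x0] := ltP 0 x; last by rewrite mulr0 mul0r mule0.
  by rewrite ltNge mulr_ge0_le0 ?(ltW x0)//= !mul0r mule0.
pose f x := Lpos (phi z * (x / s1)).
have mf : measurable_fun setT f.
  apply: (measurableT_comp measurable_Lpos).
  by apply: measurable_funM => //; exact: measurable_funM.
transitivity (\int[lambda]_x ((ratio_weight k1 k2 s1 s2 z)%:E *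
    (f x * gamma_pdf (k1 + k2).+2 (ratio_scale s1 s2 z) x)%:E))%E.
  apply: eq_integral => x _; rewrite gamma_pdf_ratio// -!EFinM; congr EFin.
  have [x0|x0] := ltP 0 x; last by rewrite /gamma_pdf ltNge x0/= !mulr0.
  rewrite /f /= powR_inv1 ?(ltW x0)//.
  by rewrite (_ : x * z * x^-1 = z) 1?mulrCA// mulrAC divff ?mul1r// gt_eqF.
rewrite ge0_integralZl//; last 3 first.
- apply/measurable_EFinP; apply: measurable_funM => //.
  exact: measurable_gamma_pdf.
- move=> x _; rewrite lee_fin mulr_ge0//; first exact: Lpos_ge0.
  by rewrite gamma_pdf_ge0// ratio_scale_gt0.
- by rewrite lee_fin ratio_weight_ge0.
congr (_ * _)%E; rewrite ge0_integral_gamma_scale//; last 2 first.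
- exact: ratio_scale_gt0.
- by move=> x; exact: Lpos_ge0.
apply: eq_integral => x _; rewrite /gamma_pdf.
case: ifPn => x0; last by rewrite !mulr0.
have s0 := ratio_scale_gt0 _ _ _ s1_gt0 s2_gt0 z0.
rewrite /f LposE; first by congr (L _ * _)%:E; ring.
by rewrite mulr_gt0 ?phi0// divr_gt0// mulr_gt0.
Qed.

End ratio_estimator.

(** * Comparison of the two risks, ratio by ratio *)

Theorem corollary2p2 (R : realType) (n1 n2 a1 a2 b1 b2 : nat)
  (ha1 : (1 <= a1)%N) (hab1 : (a1 < b1)%N) (hbn1 : (b1 <= n1)%N)
  (ha2 : (1 <= a2)%N) (hab2 : (a2 < b2)%N) (hbn2 : (b2 <= n2)%N)
  (d : measure_display) (T : measurableType d)
  (P : param R -> probability T R) (X1 X2 V1 V2 : {mfun T >-> R})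
  (hmodel : censored_exp_model n1 n2 a1 a2 b1 b2 P X1 X2 V1 V2)
  (L : R -> R)
  (hdiff : forall t : R, 0 < t -> derivable L t 1)
  (hbowl : bowl_shaped L)
  (* shape of V1, and shape of (a rescaling of) V1 given V2 / V1 *)
  (hreg1 : regular_loss L (b1 - a1))
  (hreg : regular_loss L ((b1 + b2) - (a1 + a2)))
  (c01 : R) (hc01 : is_baee_constant L P V1 c01)
  (beta : R)
  (hbeta : unique (fun c : R => 0 < c /\
     gamma_mean ((b1 + b2) - (a1 + a2) + 1) (fun z => derive1 L (c * z)) = 0%E)
     beta)
  (hle : beta <= c01) :
  forall th : param R,
    (risk L P th (delta1S1 c01 beta V1 V2) <= risk L P th (delta01 c01 V1))%E.
Proof.
move=> th; case: hc01 => -[c0 _] _; case: hbeta => -[beta0 betaE] _.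
have [indep _ _ V1_gamma V2_gamma] := hmodel th.
have s10 := sigma1_gt0 th; have s12 := sigma1_le_sigma2 th.
have s20 : 0 < sigma2 th by exact: lt_le_trans s12.
(* Shapes less one: $b-a$ becomes [(k1 + k2).+2], and the shape $b-a+1$ in the equation for [beta]
   is its successor, as [gamma_mean_ndecr] expects. *)
pose k1 := (b1 - a1).-1; pose k2 := (b2 - a2).-1.
have k1E : (b1 - a1)%N = k1.+1 by rewrite prednK// subn_gt0.
have k2E : (b2 - a2)%N = k2.+1 by rewrite prednK// subn_gt0.
have kE : (b1 + b2 - (a1 + a2))%N = (k1 + k2).+2.
  by lia.
rewrite kE addn1 in hreg betaE.
rewrite k1E in V1_gamma; rewrite k2E in V2_gamma.
have indepV (A B : set R) : measurable A -> measurable B ->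
    P th (V1 @^-1` A `&` V2 @^-1` B) =
    (P th (V1 @^-1` A) * P th (V2 @^-1` B))%E.
  move=> mA mB; have := indep setT setT A B measurableT measurableT mA mB.
  by rewrite !preimage_setT !setTI probability_setT !mul1e.
have ratioE := integral_ratio_estimator _ _ _ _ _ _ _ _ _ _ _
  s10 s20 indepV V1_gamma V2_gamma hdiff hbowl.
rewrite /risk unlock /delta1S1 /delta01.
have phi_gt0 z : 0 < z -> 0 < Num.min c01 (beta * (1 + z)).
  by move=> z0; rewrite lt_min c0 mulr_gt0// addr_gt0.
rewrite (ratioE (fun z => Num.min c01 (beta * (1 + z)))); last 2 first.
- apply: measurable_minr => //; apply: measurable_funM => //.
  exact: measurable_funD.
- exact: phi_gt0.
rewrite (ratioE (cst c01))//.
have G0 c : 0 < c -> (0 <= gamma_mean (k1 + k2).+2 (fun x => L (c * x)%R))%E.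
  move=> c_gt0; apply: integral_ge0 => x _; rewrite lee_fin.
  have [x0|x0] := ltP 0 x; last by rewrite /gamma_pdf ltNge x0 mulr0.
  rewrite mulr_ge0 ?gamma_pdf_ge0//; apply: bowl_shaped_ge0 => //.
  exact: mulr_gt0.
have t0 z : 0 < z -> 0 < ratio_scale (sigma1 th) (sigma2 th) z / sigma1 th.
  by move=> z0; rewrite divr_gt0// ratio_scale_gt0.
(* With the empty null set this is monotonicity of the integral for nonnegative, possibly
   nonmeasurable integrands. *)
apply: (@ge0_le_integral_off_null _ _ _ _ set0) => // z; last move=> _;
  case: ifPn => // z0.
- rewrite mule_ge0 ?lee_fin ?ratio_weight_ge0// G0// -mulrA mulr_gt0 ?t0//.
  exact: phi_gt0.
- by rewrite mule_ge0 ?lee_fin ?ratio_weight_ge0// G0// -mulrA mulr_gt0 ?t0.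
apply: lee_wpmul2l; first by rewrite lee_fin ratio_weight_ge0.
(* If [c01] is the minimum, the two integrands coincide at [z]. *)
have [//|/ltW small] := leP c01 (beta * (1 + z)).
apply: (gamma_mean_ndecr _ _ hdiff hbowl _ _ _ _ beta0 hreg betaE).
  (* The claim reduces to $1 + z\sigma_1/\sigma_2 \le 1 + z$, which is where the order restriction
     $\sigma_1 \le \sigma_2$ enters. *)
  rewrite -!mulrA ler_peMr ?(ltW beta0)// mulrA ler_pdivlMr// mul1r.
  rewrite /ratio_scale ler_pdivlMr; last first.
    by rewrite addr_gt0 ?divr_gt0 ?invr_gt0.
  rewrite mulrDr divff ?gt_eqF// lerD2l mulrCA ler_piMr ?(ltW z0)//.
  by rewrite ler_pdivrMr// mul1r.
by rewrite -[leLHS]mulrA -[leRHS]mulrA ler_pM2r// t0.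
Qed.
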